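(* Let $H\in(\tfrac12,1)$, and let $\rho_k$ ($k\ge 0$) and $\Gamma_n^k$ ($n\ge 2$, $2\le k\le n$) be the autocovariances and the projection coefficients of fractional Gaussian noise with Hurst index $H$, as defined in the context. Then $$\Gamma_{n+1}^{n+1}=\frac{\rho_n-\sum_{k=2}^n\Gamma_n^k\,\rho_{n+1-k}}{1-\sum_{k=2}^n\Gamma_n^k\,\rho_{k-1}},\qquad n\ge 2,$$ and $$\Gamma_{n+1}^k=\Gamma_n^k-\Gamma_{n+1}^{n+1}\,\Gamma_n^{n-k+2},\qquad n\ge 2,\ 2\le k\le n.$$
   Context: Let $B^H=\{B^H_t,t\ge0\}$ be a fractional Brownian motion with Hurst index $H$, i.e. a centred Gaussian process with covariance $\tfrac12(t^{2H}+s^{2H}-|t-s|^{2H})$, and let $\Delta_n=B^H_n-B^H_{n-1}$, $n\ge 1$, be its increments (fractional Gaussian noise). They form a stationary Gaussian sequence with autocovariance $\rho_k=\mathbb{E}\Delta_1\Delta_{k+1}=\tfrac12(|k+1|^{2H}-2|k|^{2H}+|k-1|^{2H})$, $k\ge 0$ (so $\rho_0=1$). For $n\ge 2$ the real coefficients $\Gamma_n^k$, $2\le k\le n$, are defined by $\mathbb{E}(\Delta_1\mid\Delta_2,\dots,\Delta_n)=\sum_{k=2}^n\Gamma_n^k\Delta_k$; equivalently, they are the unique solution of the linear system $\rho_{l-1}=\sum_{k=2}^n\Gamma_n^k\rho_{|l-k|}$, $2\le l\le n$ (whose coefficient matrix is nonsingular). *)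

(* Defs.v *)
From HB Require Import structures.
From mathcomp Require Import all_boot all_order all_algebra.
From mathcomp Require Import all_classical all_reals all_analysis.

Set Implicit Arguments.
Unset Strict Implicit.
Unset Printing Implicit Defensive.

Import Order.TTheory GRing.Theory Num.Theory.
Import numFieldNormedType.Exports.

Local Open Scope classical_set_scope.
Local Open Scope ring_scope.

(* [normal_prob m 0] is a uniform law in the library, so the degenerate
   Gaussian law is given separately as a Dirac mass. *)
Definition gaussian_rv d (T : measurableType d) (R : realType)
    (P : probability T R) (X : T -> R) : Prop :=
  measurable_fun [set: T] X /\
  exists m s : R, forall A : set R, measurable A ->
    P (X @^-1` A) = if s == 0 then \d_m A else normal_prob m s A.

(* Processes are indexed by all of R; only their values at times t >= 0 are
   ever constrained or used. *)
Definition gaussian_process d (T : measurableType d) (R : realType)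
    (P : probability T R) (B : R -> {RV P >-> R}) : Prop :=
  forall (n : nat) (t a : 'I_n -> R), (forall i, 0 <= t i) ->
    gaussian_rv P (fun w => \sum_(i < n) a i * B (t i) w).

Definition fractional_brownian_motion d (T : measurableType d) (R : realType)
    (P : probability T R) (H : R) (B : R -> {RV P >-> R}) : Prop :=
  [/\ gaussian_process B,
      forall t : R, 0 <= t -> 'E_P[B t]%E = 0%E
    & forall s t : R, 0 <= s -> 0 <= t ->
      covariance P (B s) (B t) =
      (2^-1 * (t `^ (2 * H) + s `^ (2 * H) - `|t - s| `^ (2 * H)))%:E].

(* Only used for n >= 1, where n.-1%:R = n - 1. *)
Definition fgn d (T : measurableType d) (R : realType) (P : probability T R)
    (B : R -> {RV P >-> R}) (n : nat) : T -> R :=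
  fun w => B n%:R w - B n.-1%:R w.

Definition fgn_autocov d (T : measurableType d) (R : realType)
    (P : probability T R) (B : R -> {RV P >-> R}) (k : nat) : R :=
  fine ('E_P[fgn B 1 \* fgn B k.+1])%E.

(* [Y] is a version of the conditional expectation of [X] given the
   sub-sigma-algebra [G]. *)
Definition is_cond_exp d (T : measurableType d) (R : realType)
    (P : probability T R) (G : set (set T)) (X Y : T -> R) : Prop :=
  [/\ P.-integrable [set: T] (EFin \o X),
      P.-integrable [set: T] (EFin \o Y),
      preimage_set_system [set: T] Y measurable `<=` G
    & forall A, G A -> (\int[P]_(w in A) (Y w)%:E = \int[P]_(w in A) (X w)%:E)%E].

Definition fgn_sigma d (T : measurableType d) (R : realType)
    (P : probability T R) (B : R -> {RV P >-> R}) (n : nat) : set (set T) :=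
  <<s \bigcup_(k in [set k : nat | (2 <= k <= n)%N])
        preimage_set_system [set: T] (fgn B k) measurable >>.

Definition fgn_projection_coef d (T : measurableType d) (R : realType)
    (P : probability T R) (B : R -> {RV P >-> R}) (Gamma : nat -> nat -> R)
    : Prop :=
  forall n : nat, (2 <= n)%N ->
    is_cond_exp P (fgn_sigma B n) (fgn B 1)
      (fun w => \sum_(2 <= k < n.+1) Gamma n k * fgn B k w).

(* Main.v *)
(* Conditioning makes [fgn B 1 - \sum_k Gamma n k * fgn B k] orthogonal in L2 to
   each [fgn B l], 2 <= l <= n: these are the normal equations of order n, a
   linear system with a symmetric Toeplitz matrix.  Reversing the indices in
   the system of order n shows that [Gamma n k - g * Gamma n (n - k + 2)],
   with g = Gamma n.+1 n.+1, solves the first n - 1 equations of order n + 1 once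
   their g-terms are moved to the right-hand side; uniqueness gives the second
   formula, and the last equation of order n + 1 then gives the first one.

   Uniqueness amounts to the linear independence of the increments.  If
   [\sum_k c k * fgn B k] vanishes in L2, so does its inner product with every
   B t; taking the second difference of that function of t with step h
   at the largest index m produces a term of exact order c m * h^(2H) coming
   from |t - m|^(2H), while every other term is O(h^2).  Since 2H < 2, c m = 0. *)

Require Import Defs.
From HB Require Import structures.
From mathcomp Require Import all_boot all_order all_algebra finmap.
From mathcomp Require Import all_classical all_reals all_analysis.
From mathcomp Require Import measurable_realfun ring lra zify.

Set Implicit Arguments.
Unset Strict Implicit.
Unset Printing Implicit Defensive.

Import Order.TTheory GRing.Theory Num.Theory.
Import numFieldNormedType.Exports.

Local Open Scope classical_set_scope.
Local Open Scope ring_scope.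

(** * Second differences of power functions *)

Lemma powR_midpoint_convex (R : realType) (p u v : R) : 1 <= p -> 0 <= u -> 0 <= v ->
  2 * ((u + v) / 2) `^ p <= u `^ p + v `^ p.
Proof.
move=> p1 u0 v0.
have h01 : (0 <= 2^-1 :> R) && (2^-1 <= 1 :> R) by lra.
have := @convex_powR R p p1 (Itv01 (andP h01).1 (andP h01).2) u v.
rewrite !inE/= !in_itv/= !andbT => /(_ u0 v0).
rewrite [X in X `^ _ <= _]convRE [X in _ <= X]convRE /= /unstable.onem.
have -> : 1 - 2^-1 = 2^-1 :> R by lra.
rewrite (_ : 2^-1 * u + 2^-1 * v = (u + v) / 2); last by lra.
move=> ?; lra.
Qed.

(** Midpoint convexity for the exponent 1 / p, applied to u^p and v^p, then raised to the power
    p. *)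
Lemma powR_midpoint_concave (R : realType) (p u v : R) : 0 < p -> p <= 1 ->
  0 <= u -> 0 <= v -> u `^ p + v `^ p <= 2 * ((u + v) / 2) `^ p.
Proof.
move=> p0 p1 u0 v0.
have q1 : 1 <= p^-1 by rewrite invf_ge1.
have := @powR_midpoint_convex R p^-1 _ _ q1 (powR_ge0 u p) (powR_ge0 v p).
rewrite -!powRrM mulfV ?gt_eqF// !powRr1// => le2.
have w0 : 0 <= (u `^ p + v `^ p) / 2.
  by rewrite divr_ge0// addr_ge0// powR_ge0.
have : (((u `^ p + v `^ p) / 2) `^ p^-1) `^ p <= ((u + v) / 2) `^ p.
  apply: ge0_ler_powR; rewrite ?nnegrE ?powR_ge0 ?divr_ge0 ?addr_ge0 ?(ltW p0)//; lra.
rewrite -powRrM mulVf ?gt_eqF// powRr1// => ?; lra.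
Qed.

(* Writing [y `^ a = (y ^+ 2) `^ (a / 2)], the lower bound is convexity of [powR]
   for the exponent a, the upper bound is concavity for the exponent a / 2. *)
Lemma powR_second_difference (R : realType) (a x h : R) : 1 <= a -> a <= 2 ->
  1 <= x -> 0 <= h -> h <= 1 ->
  `|(x + h) `^ a + (x - h) `^ a - 2 * x `^ a| <= 2 * x `^ a * h ^+ 2.
Proof.
move=> a1 a2 x1 h0 h1.
have xh0 : 0 <= x + h by lra.
have xh0' : 0 <= x - h by lra.
have x0 : 0 <= x by lra.
have lb := @powR_midpoint_convex R a _ _ a1 xh0 xh0'.
have sqE (y : R) : 0 <= y -> y `^ a = (y ^+ 2) `^ (a / 2).
  by move=> y0; rewrite -powR_mulrn// -powRrM; congr (_ `^ _); lra.
have p0 : 0 < a / 2 by lra.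
have p1 : a / 2 <= 1 by lra.
have ub := @powR_midpoint_concave R (a / 2) _ _ p0 p1 (sqr_ge0 (x + h)) (sqr_ge0 (x - h)).
rewrite -!sqE// in ub.
rewrite (_ : (x + h + (x - h)) / 2 = x) in lb; last by lra.
(* The mean of the two squares is x^2 + h^2, at most x^2 (1 + h^2) because x >= 1; then (1 +
   h^2)^(a/2) <= 1 + h^2 because a / 2 <= 1. *)
have ub2 : (((x + h) ^+ 2 + (x - h) ^+ 2) / 2) `^ (a / 2) <=
    x `^ a * (1 + h ^+ 2).
  apply: (@le_trans _ _ ((x ^+ 2 * (1 + h ^+ 2)) `^ (a / 2))).
    apply: ge0_ler_powR; rewrite ?nnegrE; [lra| | |].
    - by rewrite divr_ge0// addr_ge0// sqr_ge0.
    - by rewrite mulr_ge0 ?addr_ge0 ?sqr_ge0.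
    - have : 1 <= x ^+ 2 by rewrite expr_ge1.
      have := sqr_ge0 h; nra.
  rewrite powRM ?addr_ge0 ?sqr_ge0// -sqE// ler_wpM2l ?powR_ge0//.
  apply: ler1_powR => //; have := sqr_ge0 h; lra.
rewrite ger0_norm; lra.
Qed.

(** * Linear independence of the increments *)

(** For a = 2H the factor of [c k] is twice the covariance of [fgn B k] with [B t]. Induction on m
    removes the coefficient of largest index first. *)
Lemma fbm_increments_free (R : realType) (a : R) (c : nat -> R) (m : nat) :
  1 < a -> a < 2 ->
  (forall t : R, 0 <= t ->
    \sum_(2 <= k < m.+1) c k * (k%:R `^ a - k.-1%:R `^ a
       - `|t - k%:R| `^ a + `|t - k.-1%:R| `^ a) = 0) ->
  forall k, (2 <= k <= m)%N -> c k = 0.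
Proof.
move=> a1 a2; elim: m => [|m IH] free k km; first by lia.
have [m1|m1] := leqP m 0; first by lia.
suff cm : c m.+1 = 0.
  have [->//|ne] := eqVneq k m.+1; apply: IH; last by lia.
  move=> t t0; have := free t t0.
  by rewrite big_nat_recr ?ltnS//= cm mul0r addr0.
apply/eqP/negPn/negP => cm0.
pose n := m.+1.
(* Second central difference, at n with step h, of t |-> |t - i|^a. The terms of [free] that do not
   depend on t cancel in it, which gives [SE]. *)
pose S (h : R) (i : nat) : R := `|n%:R + h - i%:R| `^ a + `|n%:R - h - i%:R| `^ a
  - 2 * `|n%:R - i%:R| `^ a.
have SE (h : R) : 0 <= h <= 1 ->
    \sum_(2 <= k < n.+1) c k * (S h k.-1 - S h k) = 0.
  move=> /andP[h0 h1].
  have n1 : 1 <= n%:R :> R by rewrite ler1n.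
  have t1 : 0 <= n%:R + h by lra.
  have t2 : 0 <= n%:R - h by lra.
  have t3 : 0 <= n%:R :> R by lra.
  have := free _ t3; have := free _ t2; have := free _ t1.
  move=> e1 e2 e3.
  transitivity (0 + 0 - 2 * 0 : R); last by lra.
  rewrite -[X in X + _ - _]e1 -[X in _ + X - _]e2 -[X in _ - 2 * X]e3.
  rewrite mulr_sumr -sumrN -!big_split/=; apply: eq_bigr => i _.
  by rewrite /S; ring.
have Slt (h : R) i : 0 <= h <= 1 -> (i < n)%N ->
    `|S h i| <= 2 * n%:R `^ a * h ^+ 2.
  move=> /andP[h0 h1] ltin.
  have x1 : 1 <= n%:R - i%:R :> R by rewrite -natrB ?ler1n ?subn_gt0// ltnW.
  have := @powR_second_difference R a _ h (ltW a1) (ltW a2) x1 h0 h1.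
  have -> : S h i = (n%:R - i%:R + h) `^ a + (n%:R - i%:R - h) `^ a
      - 2 * (n%:R - i%:R) `^ a.
    rewrite /S (addrAC n%:R h) (addrAC n%:R (- h)).
    rewrite (@ger0_norm _ (n%:R - i%:R)); last by lra.
    by rewrite (@ger0_norm _ (_ + h)) ?(@ger0_norm _ (_ - h))//; lra.
  move=> /le_trans; apply; rewrite ler_wpM2r ?sqr_ge0// ler_wpM2l//.
  apply: ge0_ler_powR; rewrite ?nnegrE; [lra|lra|exact: ler0n|].
  have := ler0n R i; lra.
have Sn (h : R) : 0 <= h -> S h n = 2 * h `^ a.
  move=> h0; rewrite /S subrr normr0 powR0 ?gt_eqF//; last lra.
  rewrite (_ : n%:R + h - n%:R = h); last by ring.
  rewrite (_ : n%:R - h - n%:R = - h); last by ring.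
  rewrite normrN ger0_norm//; lra.
(* Each k < n contributes two differences bounded by [Slt], and k = n contributes one besides the
   exact [S h n]. Together they are at most 2 * C * h^2, and this 2 cancels against the one in
   [Sn]. *)
pose C := 2 * n%:R `^ a * \sum_(2 <= k < n.+1) `|c k|.
have C0 : 0 <= C by rewrite mulr_ge0 ?mulr_ge0 ?powR_ge0// sumr_ge0.
have bound (h : R) : 0 <= h <= 1 -> `|c n| * h `^ a <= C * h ^+ 2.
  move=> h01; have := SE h h01.
  have h0 : 0 <= h by case/andP: h01.
  rewrite big_nat_recr/=; last by rewrite /n; lia.
  rewrite Sn// => /eqP; rewrite mulrBr addrA subr_eq0 => /eqP e.
  have ma0 : 0 <= 2 * n%:R `^ a * h ^+ 2 by rewrite !mulr_ge0 ?powR_ge0 ?sqr_ge0.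
  have : `|c n * (2 * h `^ a)| <= 2 * (C * h ^+ 2).
    rewrite -e (le_trans (ler_normD _ _))//.
    have -> : 2 * (C * h ^+ 2) = \sum_(2 <= k < n) `|c k| * (2 * (2 * n%:R `^ a * h ^+ 2))
        + `|c n| * (2 * (2 * n%:R `^ a * h ^+ 2)).
      have -> : C = 2 * n%:R `^ a * (\sum_(2 <= k < n) `|c k| + `|c n|).
        by rewrite /C big_nat_recr//=; rewrite /n; lia.
      by rewrite -mulr_suml -mulrDl; ring.
    apply: lerD.
      rewrite (le_trans (ler_norm_sum _ _ _))// big_nat [leRHS]big_nat.
      apply: ler_sum => i /andP[i2 ilt]; rewrite normrM ler_wpM2l//.
      rewrite (le_trans (ler_normB _ _))// mulr2n mulrDl mul1r lerD// Slt//; lia.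
    rewrite normrM ler_wpM2l// (le_trans (Slt _ _ _ _))//; lra.
  rewrite normrM (ger0_norm (mulr_ge0 _ (powR_ge0 _ _)))//; lra.
pose e := `|c n|.
have e0 : 0 < e by rewrite normr_gt0.
(* This choice gives C * y <= e / 2 and y <= 1; adding e keeps the denominator positive even if C =
   0. *)
pose y := e / (2 * (C + e)).
have Ce0 : 0 < 2 * (C + e) by lra.
have y0 : 0 < y by rewrite divr_gt0.
have yC : y * (2 * (C + e)) = e by rewrite /y divfK// gt_eqF.
have y1 : y <= 1 by rewrite /y ler_pdivrMr//; lra.
have r1 : 1 <= (2 - a)^-1 by rewrite invf_ge1; lra.
(* [bound] at this h, where [h `^ (2 - a) = y], reads e <= C * y < e. *)
pose h := y `^ (2 - a)^-1.
have h0 : 0 < h by rewrite powR_gt0.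
have h1 : h <= 1 by rewrite (le_trans (ge1r_powR _ r1))// y0.
have h01 : 0 <= h <= 1 by rewrite (ltW h0).
have hy : h `^ (2 - a) = y.
  by rewrite /h -powRrM mulVf ?powRr1 ?(ltW y0)// gt_eqF; lra.
have := bound h h01.
have -> : h ^+ 2 = y * h `^ a.
  rewrite -hy -powRD ?(gt_eqF h0) ?implybT//.
  by rewrite -powR_mulrn ?(ltW h0)//; congr (_ `^ _); ring.
rewrite mulrA ler_pM2r ?powR_gt0// -/e; nra.
Qed.

(** * The recursion for symmetric Toeplitz systems *)

(* With truncated subtraction, [k - l + (l - k)] is the lag |k - l|. *)
Lemma durbin_levinson (F : fieldType) (rho : nat -> F) (g g' : nat -> F) (n : nat) :
  (2 <= n)%N -> rho 0 = 1 ->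
  (forall (m : nat) (a : nat -> F),
    (forall l, (2 <= l <= m)%N -> \sum_(2 <= k < m.+1) a k * rho (k - l + (l - k))%N = 0) ->
    forall k, (2 <= k <= m)%N -> a k = 0) ->
  (forall l, (2 <= l <= n)%N ->
    \sum_(2 <= k < n.+1) g k * rho (k - l + (l - k))%N = rho l.-1) ->
  (forall l, (2 <= l <= n.+1)%N ->
    \sum_(2 <= k < n.+2) g' k * rho (k - l + (l - k))%N = rho l.-1) ->
  g' n.+1 = (rho n - \sum_(2 <= k < n.+1) g k * rho (n.+1 - k)%N) /
      (1 - \sum_(2 <= k < n.+1) g k * rho k.-1) /\
  (forall k, (2 <= k <= n)%N -> g' k = g k - g' n.+1 * g (n - k + 2)%N).
Proof.
move=> n2 rho0 nondeg eq_g eq_g'.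
have rev (f : nat -> F) : \sum_(2 <= k < n.+1) f (n - k + 2)%N = \sum_(2 <= k < n.+1) f k.
  rewrite [RHS]big_nat_rev/=; apply: eq_big_nat => k kn; congr f; lia.
have split_g' l : (2 <= l <= n.+1)%N ->
    \sum_(2 <= k < n.+1) g' k * rho (k - l + (l - k))%N +
      g' n.+1 * rho (n.+1 - l)%N = rho l.-1.
  move=> ln; rewrite -eq_g'// [RHS]big_nat_recr/=; last lia.
  congr (_ + _ * rho _)%R; lia.
(* Reversing both k and l preserves the lag, so the reversed [g] solves the backward problem: it
   predicts the variable of index n + 1 from those of indices 2 to n. *)
have refl l : (2 <= l <= n)%N ->
    \sum_(2 <= k < n.+1) g (n - k + 2)%N * rho (k - l + (l - k))%N = rho (n.+1 - l)%N.
  move=> ln; have := eq_g (n - l + 2)%N; rewrite (_ : (n - l + 2).-1 = n.+1 - l)%N; last lia.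
  move=> <-; last lia.
  rewrite -[RHS]rev//; apply: eq_big_nat => k kn; congr (_ * rho _); lia.
have g'E k : (2 <= k <= n)%N -> g' k = g k - g' n.+1 * g (n - k + 2)%N.
  move=> kn.
  apply/eqP; rewrite -subr_eq0; apply/eqP.
  apply: (nondeg n (fun j => g' j - (g j - g' n.+1 * g (n - j + 2)%N))) => // l ln.
  have := split_g' l ltac:(lia); rewrite -refl// -eq_g// mulr_sumr => e.
  transitivity (\sum_(2 <= k < n.+1) g' k * rho (k - l + (l - k))%N +
     \sum_(2 <= i < n.+1) g' n.+1 * (g (n - i + 2)%N * rho (i - l + (l - i))%N) -
     \sum_(2 <= k < n.+1) g k * rho (k - l + (l - k))%N); last by rewrite e subrr.
  rewrite -sumrN -!big_split/=; apply: eq_bigr => i _; ring.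
have D0 : 1 - \sum_(2 <= k < n.+1) g k * rho k.-1 != 0.
  (* Otherwise (1, - g 2, ..., - g n), shifted by one index, is in the kernel. *)
  apply/eqP => D0.
  pose a j := if j == 2%N then 1 else - g j.-1.
  suff /nondeg/(_ 2%N) : forall l, (2 <= l <= n.+1)%N ->
      \sum_(2 <= k < n.+2) a k * rho (k - l + (l - k))%N = 0.
    by move=> /(_ ltac:(lia)); rewrite /a eqxx => /eqP; rewrite oner_eq0.
  move=> l ln; rewrite big_nat_recl/=; last lia.
  rewrite {1}/a eqxx mul1r.
  have -> : \sum_(2 <= k < n.+1) a k.+1 * rho (k.+1 - l + (l - k.+1))%N =
      - \sum_(2 <= k < n.+1) g k * rho (k - l.-1 + (l.-1 - k))%N.
    rewrite -sumrN; apply: eq_big_nat => k kn.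
    rewrite /a (_ : (k.+1 == 2)%N = false) /= ?mulNr; last by lia.
    congr (- (_ * rho _)); lia.
  (* Row l = 2 is [D0] itself; row l > 2 is the normal equation of index l - 1. *)
  have [->/=|l2] := eqVneq l 2%N.
    rewrite -[RHS]D0 rho0; congr (_ - _); apply: eq_big_nat => k kn; congr (_ * rho _); lia.
  rewrite eq_g; last by move/eqP: l2; lia.
  rewrite (_ : (2 - l + (l - 2) = l.-1.-1)%N) ?subrr//; lia.
split => //.
apply: (canRL (mulfK D0)).
(* In the last equation, l = n + 1, substituting [g'E] gives [g' n.+1] the factor 1 minus a sum over
   the reversed [g]; by [rev] this is the denominator. *)
have := split_g' n.+1 ltac:(lia).
rewrite subnn rho0 mulr1 /= => <-.
rewrite -(rev (fun k => g k * rho k.-1)).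
have -> : \sum_(2 <= k < n.+1) g' k * rho (k - n.+1 + (n.+1 - k))%N =
    \sum_(2 <= k < n.+1) (g k * rho (n.+1 - k)%N -
      g' n.+1 * (g (n - k + 2)%N * rho (n.+1 - k)%N)).
  apply: eq_big_nat => k kn; rewrite g'E; last lia.
  rewrite (_ : k - n.+1 + (n.+1 - k) = n.+1 - k)%N; last lia.
  ring.
rewrite sumrB -mulr_sumr mulrBr mulr1.
rewrite (eq_big_nat _ _ (F1 := fun k => g (n - k + 2)%N * rho (n.+1 - k)%N)
  (F2 := fun k => g (n - k + 2)%N * rho (n - k + 2).-1)); first by ring.
by move=> k kn; congr (_ * rho _); lia.
Qed.

(** * Orthogonality of the residual of a conditional expectation *)

Section simple_functions.
Import HBNNSimple.

(** The hypothesis on preimages is the case of indicators, and linearity extends it to simple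
    functions. Since X may change sign, the limit is taken by dominated convergence: the
    approximations satisfy 0 <= [phi n] <= f, so |X * f(Z)| dominates. *)
Lemma integral_mul_comp_eq0 (d : measure_display) (T : measurableType d)
    (R : realType) (mu : {measure set T -> \bar R}) (X Z : T -> R) (f : R -> R) :
  mu.-integrable [set: T] (EFin \o X) ->
  measurable_fun [set: T] Z ->
  measurable_fun [set: R] f -> (forall x, 0 <= f x) ->
  mu.-integrable [set: T] (EFin \o (X \* (f \o Z))) ->
  (forall A, measurable A -> \int[mu]_(w in Z @^-1` A) (X w)%:E = 0)%E ->
  (\int[mu]_w (X w * f (Z w))%:E = 0)%E.
Proof.
move=> iX mZ mf f0 iXf X0.
have mX : measurable_fun [set: T] X by apply/measurable_EFinP; case/integrableP: iX.
have mF : measurable_fun [set: R] (EFin \o f) by exact/measurable_EFinP.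
pose phi n := nnsfun_approx measurableT mF n.
pose h n w := (X w * phi n (Z w))%:E.
have mphiZ n : measurable_fun [set: T] (phi n \o Z) by exact: measurableT_comp.
have h0 n : (\int[mu]_w h n w = 0)%E.
  pose s := fset_set (range (phi n)).
  pose A y := Z @^-1` (phi n @^-1` [set y]).
  rewrite /h.
  transitivity (\int[mu]_w
      (\sum_(i < #|` s|) (s`_i)%:E * (X w * \1_(A s`_i) w)%:E))%E.
    apply: eq_integral => w _; rewrite fimfunEord mulr_sumr -sumEFin.
    by apply: eq_bigr => i _; rewrite -EFinM mulrCA.
  have mA (y : R) : measurable (A y).
    by rewrite -[X in measurable X]setTI; exact: mZ.
  have iXA (y : R) : mu.-integrable [set: T] (fun w => (X w * \1_(A y) w)%:E).
    rewrite (_ : (fun w => _) = EFin \o (X \_ (A y))).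
      rewrite -restrict_EFin; apply: (integrable_mkcond _ _).1 => //.
      exact: (integrableS measurableT).
    by rewrite patch_indic.
  rewrite integral_sum//; last by move=> i; exact: integrableZl.
  rewrite big1// => i _; rewrite integralZl//.
  rewrite [X in (_ * X)%E](_ : _ = 0%E) ?mule0//.
  rewrite -[RHS](X0 (phi n @^-1` [set s`_i])) ?setTI//.
  rewrite [RHS]integral_mkcond epatch_indic.
  by apply: eq_integral => w _ /=; rewrite EFinM.
have [|||||_ _] := @dominated_convergence _ T R mu setT measurableT h
  (fun w => (X w * f (Z w))%:E) (fun w => `|X w * f (Z w)|%:E).
- by move=> n; apply/measurable_EFinP; apply: measurable_funM => //; exact: mphiZ.
- by apply/measurable_EFinP; apply: measurable_funM => //; exact: measurableT_comp.
- apply: aeW => w _; rewrite /h; under eq_fun do rewrite EFinM.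
  rewrite EFinM; apply: cvgeZl => //.
  exact: (@cvg_nnsfun_approx _ _ _ _ measurableT _ mF (fun _ _ => f0 _) (Z w) I).
- have := integrable_abse iXf; apply: eq_integrable => // w _ /=.
- apply: aeW => w n _; rewrite /h lee_fin !normrM ler_wpM2l//.
  rewrite !ger0_norm// /phi nnsfun_approxE -lee_fin.
  by apply: le_approx => // x _; rewrite lee_fin.
under eq_fun do rewrite h0.
by move=> cv; apply: (cvg_unique (@ereal_hausdorff R) cv); exact: cvg_cst.
Qed.

End simple_functions.

(** Preimages under Z lie in G, so X - Y integrates to 0 over each of them. The previous lemma then
    applies to the positive and negative parts of Z, both bounded by |Z|, which keeps the products
    integrable. *)
Lemma cond_exp_orthogonal (d : measure_display) (T : measurableType d)
    (R : realType) (P : probability T R) (G : set (set T)) (X Y Z : T -> R) :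
  is_cond_exp P G X Y ->
  measurable_fun [set: T] Z ->
  preimage_set_system [set: T] Z measurable `<=` G ->
  P.-integrable [set: T] (EFin \o ((X \- Y) \* Z)) ->
  ('E_P[((X \- Y) \* Z)%R] = 0)%E.
Proof.
move=> [iX iY _ XY] mZ ZG iXYZ.
have iXY : P.-integrable [set: T] (EFin \o (X \- Y)).
  apply: (@eq_integrable _ _ _ _ _ measurableT (fun w => (X w)%:E - (Y w)%:E)%E) => //.
  exact: integrableB.
have XY0 A : measurable A -> (\int[P]_(w in Z @^-1` A) ((X \- Y) w)%:E = 0)%E.
  move=> mA.
  have mZA : measurable (Z @^-1` A) by rewrite -[X in measurable X]setTI; exact: mZ.
  have GA : G (Z @^-1` A) by apply: ZG; exists A => //; rewrite setTI.
  rewrite integralB_EFin//; [|exact: (integrableS measurableT)..].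
  rewrite XY// subee// integrable_fin_num//; exact: (integrableS measurableT).
pose p (x : R) := Num.max x 0; pose q (x : R) := Num.max (- x) 0.
have mp : measurable_fun [set: R] p by exact: measurable_maxr.
have mq : measurable_fun [set: R] q by exact: measurable_maxr.
have dom (f : R -> R) : measurable_fun [set: R] f -> (forall x, `|f x| <= `|x|) ->
    P.-integrable [set: T] (EFin \o ((X \- Y) \* (f \o Z))).
  move=> mf fle; apply: le_integrable iXYZ => //.
    apply/measurable_EFinP; apply: measurable_funM; last exact: measurableT_comp.
    by apply/measurable_EFinP; exact: measurable_int iXY.
  by move=> w _; rewrite /= lee_fin !normrM ler_wpM2l.
have ip : P.-integrable [set: T] (EFin \o ((X \- Y) \* (p \o Z))).
  by apply: dom => // x; rewrite /p; case: (leP x 0) => // _; rewrite normr0.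
have iq : P.-integrable [set: T] (EFin \o ((X \- Y) \* (q \o Z))).
  by apply: dom => // x; rewrite /q; case: (leP (- x) 0) => // _; rewrite ?normrN ?normr0.
have -> : (X \- Y) \* Z = ((X \- Y) \* (p \o Z)) \- ((X \- Y) \* (q \o Z)).
  apply/funext => w /=; rewrite -mulrBr; congr (_ * _); rewrite /p /q.
  by case: (leP (Z w) 0); case: (leP (- Z w) 0) => *; lra.
rewrite unlock integralB_EFin//.
have p0 x : 0 <= p x by rewrite /p le_max lexx orbT.
have q0 x : 0 <= q x by rewrite /q le_max lexx orbT.
rewrite (integral_mul_comp_eq0 iXY mZ mp p0 ip XY0).
by rewrite (integral_mul_comp_eq0 iXY mZ mq q0 iq XY0) sube0.
Qed.

(** * The inner product of L2 *)

(** The L2 inner product as a real number; for arguments in L2 the expectation is finite, so [fine]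
    loses nothing. *)
Definition mean_prod {d : measure_display} {T : measurableType d} {R : realType}
  (P : probability T R) (X Y : T -> R) : R := fine ('E_P[X \* Y])%E.

Section mean_prod.
Context {d : measure_display} {T : measurableType d} {R : realType}.
Variable P : probability T R.
Implicit Types X Y Z : T -> R.
Local Notation L2 := (Lfun P 2%:E).
Local Notation ip := (mean_prod P).

Lemma Lfun2_sqr X : measurable_fun [set: T] X -> ('E_P[X \* X] < +oo)%E ->
  X \in L2.
Proof.
move=> mX X2; rewrite inE; apply/andP; split; rewrite inE/=; first exact: mX.
rewrite /finite_norm unlock poweR_lty//.
move: X2; rewrite unlock; apply: le_lt_trans.
rewrite le_eqVlt; apply/orP; left; apply/eqP; apply: eq_integral => w _ /=.
by rewrite powR_mulrn// real_normK// num_real.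
Qed.

Lemma mean_prodC X Y : ip X Y = ip Y X.
Proof.
by rewrite /mean_prod; congr (fine 'E_P[_]); apply/funext => w /=; rewrite mulrC.
Qed.

Lemma mean_prodDl X Y Z : X \in L2 -> Y \in L2 -> Z \in L2 ->
  ip (X \+ Y) Z = ip X Z + ip Y Z.
Proof.
move=> LX LY LZ; rewrite /mean_prod -fineD ?expectation_fin_num ?Lfun2_mul_Lfun1//.
rewrite -expectationD ?Lfun2_mul_Lfun1//; congr (fine 'E_P[_]).
by apply/funext => w /=; rewrite mulrDl.
Qed.

Lemma Lfun2Z a X : X \in L2 -> (fun w => a * X w) \in L2.
Proof.
move=> LX; rewrite (_ : (fun w => _) = (a \o* X)).
  by apply: Lfun_scale => //; rewrite ler1n.
by apply/funext => w /=; rewrite mulrC.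
Qed.

Lemma mean_prodZl a X Y : X \in L2 -> Y \in L2 ->
  ip (fun w => a * X w) Y = a * ip X Y.
Proof.
move=> LX LY; rewrite /mean_prod.
have LXY := Lfun2_mul_Lfun1 LX LY.
have -> : ('E_P[((fun w => a * X w) \* Y)%R] = a%:E * 'E_P[(X \* Y)%R])%E.
  rewrite -expectationZl//; congr ('E_P[_])%E.
  by apply/funext => w /=; rewrite -mulrA mulrC.
by rewrite fineM ?expectation_fin_num.
Qed.

Lemma Lfun2D X Y : X \in L2 -> Y \in L2 -> X \+ Y \in L2.
Proof. by move=> LX LY; rewrite rpredD ?lee1n. Qed.

Lemma Lfun2B X Y : X \in L2 -> Y \in L2 -> X \- Y \in L2.
Proof. by move=> LX LY; rewrite rpredB ?lee1n. Qed.

Lemma mean_prodBl X Y Z : X \in L2 -> Y \in L2 -> Z \in L2 ->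
  ip (X \- Y) Z = ip X Z - ip Y Z.
Proof.
move=> LX LY LZ.
have -> : X \- Y = X \+ (fun w => (-1) * Y w).
  by apply/funext => w /=; rewrite mulN1r.
by rewrite mean_prodDl ?mean_prodZl ?Lfun2Z// mulN1r.
Qed.

Lemma Lfun2_sum (r : seq nat) (a : nat -> R) (X : nat -> T -> R) :
  (forall k, X k \in L2) -> (fun w => \sum_(k <- r) a k * X k w) \in L2.
Proof.
move=> LX; elim: r => [|k r IH].
  rewrite (_ : (fun w => _) = cst 0); first exact: Lfun_cst.
  by apply/funext => w; rewrite big_nil.
rewrite (_ : (fun w => _) = (fun w => a k * X k w) \+ (fun w => \sum_(k <- r) a k * X k w)).
  by rewrite Lfun2D ?Lfun2Z.
by apply/funext => w; rewrite big_cons.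
Qed.

Lemma mean_prod_suml (r : seq nat) (a : nat -> R) (X : nat -> T -> R) Y :
  (forall k, X k \in L2) -> Y \in L2 ->
  ip (fun w => \sum_(k <- r) a k * X k w) Y = \sum_(k <- r) a k * ip (X k) Y.
Proof.
move=> LX LY; elim: r => [|k r IH].
  rewrite big_nil /mean_prod (_ : _ \* _ = cst 0) ?expectation_cst//.
  by apply/funext => w /=; rewrite big_nil mul0r.
rewrite big_cons -IH -mean_prodZl// -mean_prodDl ?Lfun2Z ?Lfun2_sum//.
by congr (ip _ _); apply/funext => w; rewrite big_cons.
Qed.

Lemma mean_prod_ge0 X : 0 <= ip X X.
Proof. by apply: fine_ge0; apply: expectation_ge0 => w; rewrite /= -expr2 sqr_ge0. Qed.

(** The squared norm of t X + Z is affine in t when X has norm 0; being nonnegative for all t, it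
    has slope 0. *)
Lemma mean_prod_null X Z : X \in L2 -> Z \in L2 -> ip X X = 0 -> ip X Z = 0.
Proof.
move=> LX LZ X0.
have q (t : R) : 0 <= 2 * t * ip X Z + ip Z Z.
  have LtX := Lfun2Z t LX.
  have tXr W : W \in L2 -> ip W (fun w => t * X w) = t * ip X W.
    by move=> LW; rewrite mean_prodC mean_prodZl.
  have := mean_prod_ge0 ((fun w => t * X w) \+ Z).
  rewrite mean_prodDl ?Lfun2D// !(mean_prodC _ (_ \+ Z)) !mean_prodDl//.
  rewrite !tXr// mean_prodZl// X0.
  by move=> ?; lra.
apply/eqP; apply: contraT => ne.
(* At this t the affine function takes the value -1. *)
have := q (- (ip Z Z + 1) / (2 * ip X Z)).
rewrite (_ : _ + _ = -1); first by rewrite lerNr oppr0 ler10.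
by field.
Qed.

End mean_prod.

(** * Covariances and normal equations of fractional Gaussian noise *)

Section fgn.
Context {d : measure_display} {T : measurableType d} {R : realType}.
Variables (P : probability T R) (H : R) (B : R -> {RV P >-> R}).
Hypothesis fbmB : fractional_brownian_motion H B.
Local Notation ip := (mean_prod P).
Local Notation L2 := (Lfun P 2%:E).
Local Notation rho := (fgn_autocov B).

Lemma fbm_mean_prod_cov (s t : R) : 0 <= s -> 0 <= t ->
  ('E_P[((B s : T -> R) \* (B t : T -> R))%R])%E =
  (2^-1 * (t `^ (2 * H) + s `^ (2 * H) - `|t - s| `^ (2 * H)))%:E.
Proof.
case: fbmB => _ B0 covB s0 t0; rewrite -covB// covariance.unlock !B0//=.
congr expectation; apply/funext => w.
by rewrite -[RHS]/((B s w - 0) * (B t w - 0)) !subr0.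
Qed.

Lemma fbm_Lfun2 (t : R) : 0 <= t -> (B t : T -> R) \in L2.
Proof.
move=> t0; apply: Lfun2_sqr; first exact: measurable_funPT.
by rewrite fbm_mean_prod_cov// ltry.
Qed.

Lemma fgn_Lfun2 (k : nat) : fgn B k \in L2.
Proof. by apply: Lfun2B; exact: fbm_Lfun2. Qed.

Lemma mean_prod_fgn_fbm (k : nat) (t : R) : 0 <= t ->
  ip (fgn B k) (B t) = 2^-1 * (k%:R `^ (2 * H) - k.-1%:R `^ (2 * H)
    - `|t - k%:R| `^ (2 * H) + `|t - k.-1%:R| `^ (2 * H)).
Proof.
move=> t0; rewrite [fgn B k](_ : _ = (B k%:R : T -> R) \- B k.-1%:R)//.
rewrite mean_prodBl ?fbm_Lfun2// /mean_prod !fbm_mean_prod_cov//=; ring.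
Qed.

(** The autocovariance extended to signed real lags. It is even, so the order of the two indices
    matters only when passing to the natural lag in [mean_prod_fgn]. *)
Let gam (x : R) := 2^-1 * (`|x + 1| `^ (2 * H) + `|x - 1| `^ (2 * H)
  - 2 * `|x| `^ (2 * H)).

Lemma mean_prod_fgn_lag (k l : nat) : (0 < k)%N -> (0 < l)%N ->
  ip (fgn B k) (fgn B l) = gam (l%:R - k%:R).
Proof.
move=> k0 l0; rewrite mean_prodC [fgn B l](_ : _ = (B l%:R : T -> R) \- B l.-1%:R)//.
rewrite mean_prodBl ?fbm_Lfun2 ?fgn_Lfun2// !(mean_prodC P _ (fgn B k)).
rewrite !mean_prod_fgn_fbm// /gam -!subn1 !natrB//.
rewrite (_ : l%:R - (k%:R - 1) = l%:R - k%:R + 1 :> R); last by ring.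
rewrite (_ : l%:R - 1 - k%:R = l%:R - k%:R - 1 :> R); last by ring.
rewrite (_ : l%:R - 1 - (k%:R - 1) = l%:R - k%:R :> R); last by ring.
ring.
Qed.

Lemma fgn_autocovE (k : nat) : rho k = gam k%:R.
Proof.
rewrite -[rho k]/(ip (fgn B 1) (fgn B k.+1)) mean_prod_fgn_lag//.
by rewrite -natrB// subn1.
Qed.

Lemma fgn_autocov0 : 2^-1 < H -> rho 0 = 1.
Proof.
move=> H12; rewrite fgn_autocovE /gam add0r sub0r normrN normr0 normr1 powR1.
rewrite powR0; last by rewrite gt_eqF//; lra.
by rewrite mulr0 subr0 mulVf ?pnatr_eq0.
Qed.

Lemma mean_prod_fgn (k l : nat) : (0 < k)%N -> (0 < l)%N ->
  ip (fgn B k) (fgn B l) = rho (k - l + (l - k))%N.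
Proof.
move=> k0 l0; rewrite mean_prod_fgn_lag// fgn_autocovE.
have [kl|/ltnW lk] := leqP k l.
  by rewrite (eqP kl) add0n natrB.
rewrite (eqP lk) addn0 natrB// -(opprB k%:R) /gam.
move: (k%:R - l%:R) => x.
rewrite (_ : - x + 1 = - (x - 1)); last by ring.
rewrite (_ : - x - 1 = - (x + 1)); last by ring.
by rewrite !normrN (addrC (`|x - 1| `^ _)).
Qed.

Lemma fgn_normal_equations (Gamma : nat -> nat -> R) (n l : nat) :
  fgn_projection_coef B Gamma -> (2 <= l <= n)%N ->
  \sum_(2 <= k < n.+1) Gamma n k * rho (k - l + (l - k))%N = rho l.-1.
Proof.
move=> projG ln.
have L2S := Lfun2_sum (index_iota 2 n.+1) (Gamma n) fgn_Lfun2.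
have Ll := fgn_Lfun2 l.
have L1 := Lfun2B (fgn_Lfun2 1) L2S.
have ml : measurable_fun [set: T] (fgn B l).
  by apply: measurable_funB; exact: measurable_funPT.
have n2 : (2 <= n)%N by lia.
have := cond_exp_orthogonal (projG n n2) ml.
move=> /(_ _ _)/(congr1 fine)/= e.
have : ip (fgn B 1 \- (fun w => \sum_(2 <= k < n.+1) Gamma n k * fgn B k w)) (fgn B l) = 0.
  apply: e; first by move=> A hA; apply: sub_sigma_algebra; exists l.
  by apply/Lfun1_integrable; exact: Lfun2_mul_Lfun1.
rewrite mean_prodBl ?fgn_Lfun2// mean_prod_suml//; last exact: fgn_Lfun2.
move=> /subr0_eq; rewrite mean_prod_fgn//; last lia.
rewrite (_ : 1 - l + (l - 1) = l.-1)%N; last lia.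
move=> ->; apply: eq_big_nat => k kn; rewrite mean_prod_fgn//; lia.
Qed.

(** For a vector a in the kernel of the Toeplitz matrix, the squared norm of [W] is the quadratic
    form of that matrix at a, hence 0. So [W] is orthogonal to every [B t], which is the hypothesis
    of [fbm_increments_free] up to the factor 1/2. *)
Lemma fgn_nondegenerate (m : nat) (a : nat -> R) : 2^-1 < H -> H < 1 ->
  (forall l, (2 <= l <= m)%N ->
    \sum_(2 <= k < m.+1) a k * rho (k - l + (l - k))%N = 0) ->
  forall k, (2 <= k <= m)%N -> a k = 0.
Proof.
move=> H12 H1 a0; apply: (@fbm_increments_free R (2 * H)); [lra|lra|].
pose W w := \sum_(2 <= k < m.+1) a k * fgn B k w.
have LW : W \in L2 := Lfun2_sum _ _ fgn_Lfun2.
have WW : ip W W = 0.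
  rewrite {1}/W mean_prod_suml//; last exact: fgn_Lfun2.
  rewrite big_nat big1// => l ln.
  rewrite mean_prodC mean_prod_suml ?fgn_Lfun2//; last exact: fgn_Lfun2.
  rewrite [X in _ * X](_ : _ = 0) ?mulr0// -[RHS](a0 l)//.
  apply: eq_big_nat => k kn; rewrite mean_prod_fgn//; lia.
move=> t t0.
have := mean_prod_null LW (fbm_Lfun2 t0) WW.
rewrite mean_prod_suml ?fbm_Lfun2//; last exact: fgn_Lfun2.
move=> e; apply: (mulfI (_ : 2^-1 != 0 :> R)); first by rewrite invr_eq0 pnatr_eq0.
rewrite mulr0 -[RHS]e mulr_sumr; apply: eq_bigr => k _.
by rewrite mean_prod_fgn_fbm// mulrCA.
Qed.

End fgn.

Unset Implicit Arguments.

Theorem proposition2p16 (d : measure_display) (T : measurableType d)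
    (R : realType) (P : probability T R) (H : R) (B : R -> {RV P >-> R})
    (Gamma : nat -> nat -> R) :
  2^-1 < H -> H < 1 ->
  fractional_brownian_motion H B ->
  fgn_projection_coef B Gamma ->
  let rho := fgn_autocov B in
  (forall n : nat, (2 <= n)%N ->
    Gamma n.+1 n.+1 =
      (rho n - \sum_(2 <= k < n.+1) Gamma n k * rho (n.+1 - k)%N) /
      (1 - \sum_(2 <= k < n.+1) Gamma n k * rho k.-1)) /\
  (forall n k : nat, (2 <= n)%N -> (2 <= k <= n)%N ->
    Gamma n.+1 k = Gamma n k - Gamma n.+1 n.+1 * Gamma n (n - k + 2)%N).
Proof.
move=> H12 H1 fbmB projG rho.
have DL n (n2 : (2 <= n)%N) := durbin_levinson n2 (fgn_autocov0 fbmB H12)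
  (fun m a => @fgn_nondegenerate _ _ _ _ _ _ fbmB m a H12 H1)
  (fun l => @fgn_normal_equations _ _ _ _ _ _ fbmB Gamma n l projG)
  (fun l => @fgn_normal_equations _ _ _ _ _ _ fbmB Gamma n.+1 l projG).
by split=> [n /DL[]//|n k /DL[_ +]]; apply.
Qed.
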